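(* Let $\xi$ be a vector of $n$ i.i.d. standard Gaussian random variables, let $0<\epsilon\le\frac12$, and let $$C := \{(a,b,x)\in\mathbb{R}\times\mathbb{R}\times\mathbb{R}^n : \mathbb{P}(a\le x^T\xi\le b)\ge 1-\epsilon\}.$$ Then $C$ is the projection (onto the variables $(a,b,x)$) of the convex set $$\{(a,b,x,t)\in\mathbb{R}\times\mathbb{R}\times\mathbb{R}^n\times\mathbb{R} : \|x\|_2\le t,\ (a,b,t)\in\bar S_\epsilon\},$$ and hence $C$ is convex.
   Context: For $\epsilon\in(0,1)$, $S_\epsilon := \{(x,y)\in\mathbb{R}^2 : \mathbb{P}(x\le\zeta\le y)\ge 1-\epsilon\}$, where $\zeta\sim N(0,1)$ is a standard Gaussian random variable; and $\bar S_\epsilon := \operatorname{cl}\{(x,y,z)\in\mathbb{R}^3 : z>0,\ (x/z,y/z)\in S_\epsilon\}$, where $\operatorname{cl}$ denotes topological closure. *)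

(* Defs.v *)
From HB Require Import structures.
From mathcomp Require Import all_boot all_order all_algebra.
From mathcomp Require Import all_classical all_reals all_analysis.

Set Implicit Arguments.
Unset Strict Implicit.
Unset Printing Implicit Defensive.

Import Order.TTheory GRing.Theory Num.Theory.
Import numFieldTopology.Exports numFieldNormedType.Exports.

Local Open Scope classical_set_scope.
Local Open Scope ring_scope.

(* The second argument of normal_prob is the standard deviation. *)
Definition std_gaussian (R : realType) (d : measure_display)
    (T : measurableType d) (P : probability T R) (X : {RV P >-> R}) : Prop :=
  forall A : set R, measurable A ->
    distribution P X A = normal_prob 0 1 A.

Definition mutually_independent (R : realType) (d : measure_display)
    (T : measurableType d) (P : probability T R) (I : finType)
    (X : I -> {RV P >-> R}) : Prop :=
  forall (J : {set I}) (A : I -> set R), (forall i, measurable (A i)) ->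
    P (\bigcap_(i in [set` J]) (X i @^-1` A i)) =
    (\prod_(i in J) P (X i @^-1` A i))%E.

Definition iid_std_gaussian (R : realType) (d : measure_display)
    (T : measurableType d) (P : probability T R) (n : nat)
    (xi : 'I_n -> {RV P >-> R}) : Prop :=
  mutually_independent xi /\ forall i, std_gaussian (xi i).

(* The norm `|x| that MathComp-Analysis puts on matrices is the sup norm. *)
Definition l2norm (R : realType) (n : nat) (x : 'cV[R]_n) : R :=
  Num.sqrt (\sum_(i < n) x i 0 ^+ 2).

Definition S_eps (R : realType) (d : measure_display) (T : measurableType d)
    (P : probability T R) (zeta : {RV P >-> R}) (eps : R) : set (R * R) :=
  [set p : R * R | ((1 - eps)%:E <= P [set w | p.1 <= zeta w <= p.2]%R)%E].

Definition Sbar_eps (R : realType) (d : measure_display) (T : measurableType d)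
    (P : probability T R) (zeta : {RV P >-> R}) (eps : R) :
    set (R * R * R) :=
  closure [set q : R * R * R | let: (x, y, z) := q in
                   0 < z /\ S_eps zeta eps (x / z, y / z)].

(* The factors are written R^o so that the products below carry their
   R-module structure, which convex_set requires. *)
Definition chance_set (R : realType) (d : measure_display)
    (T : measurableType d) (P : probability T R) (n : nat)
    (xi : 'I_n -> {RV P >-> R}) (eps : R) :
    set (R^o * R^o * 'cV[R]_n) :=
  [set p : R^o * R^o * 'cV[R]_n | let: (a, b, x) := p in
    ((1 - eps)%:E <= P [set w | a <= \sum_(i < n) x i 0 * xi i w <= b]%R)%E].

Definition lifted_set (R : realType) (d : measure_display)
    (T : measurableType d) (P : probability T R) (zeta : {RV P >-> R})
    (n : nat) (eps : R) : set (R^o * R^o * 'cV[R]_n * R^o) :=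
  [set q : R^o * R^o * 'cV[R]_n * R^o | let: (a, b, x, t) := q in
    l2norm x <= t /\ Sbar_eps zeta eps (a, b, t)].

Arguments lifted_set {R d T P} zeta n eps _.

(* Main.v *)
(* For x <> 0 the variable x^T xi is centred Gaussian with standard deviation
   |x|_2, so (a,b,x) satisfies the chance constraint iff
   Phi(b/|x|) - Phi(a/|x|) >= 1 - eps, where Phi is the standard normal
   distribution function.  As 1 - eps >= 1/2, this forces a <= 0 <= b.  On
   that region (u,v) |-> Phi v - Phi u is concave, since the Gaussian density
   decreases away from 0, so S_eps and its perspective cone are convex; and
   Phi(b/t) - Phi(a/t) decreases with t, so |x| may be relaxed to any
   t >= |x|.  The closure only adds the points (a,b,0) with a <= 0 <= b,
   which are exactly the ones needed for x = 0. *)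

From HB Require Import structures.
Require Import Defs.
From mathcomp Require Import all_boot all_order all_algebra.
From mathcomp Require Import all_classical all_reals all_analysis.
From mathcomp Require Import measurable_realfun ring lra.

Set Implicit Arguments.
Unset Strict Implicit.
Unset Printing Implicit Defensive.

Import Order.TTheory GRing.Theory Num.Theory.
Import numFieldTopology.Exports numFieldNormedType.Exports.

Local Open Scope classical_set_scope.
Local Open Scope ring_scope.

(** * Linear combinations of independent Gaussian variables *)

Section GaussianLaws.
Context {R : realType}.
Local Notation mu := (@lebesgue_measure R).
Implicit Types (m s t : R) (A : set R).

Lemma measurable_affine m s : measurable_fun setT (fun v : R => m + s * v).
Proof. by apply: measurable_funD => //; exact: measurable_funM. Qed.

(** Scaled by [|s|], the pushforward of Lebesgue measure along the affine map gives []a, b]] its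
    length, and Lebesgue measure is the only measure doing so. A negative [s] turns the half-open
    interval around without changing its length. *)
Lemma lebesgue_measure_affine m s A : s != 0 -> measurable A ->
  mu ((fun v => m + s * v) @^-1` A) = (`|s|^-1%:E * mu A)%E.
Proof.
move=> s0 mA.
have ns0 : 0 < `|s| by rewrite normr_gt0.
pose f : measurableTypeR R -> measurableTypeR R := fun v => m + s * v.
have mf : measurable_fun setT f by exact: measurable_affine.
pose nu := mscale (NngNum (ltW ns0)) mu.
suff -> : mu A = pushforward nu f A.
  by rewrite /nu/mscale/= /pushforward/= muleA -EFinM mulVf ?gt_eqF// mul1e.
apply: lebesgue_measure_unique => // _ [[a b] /= ab <-].
rewrite /pushforward/nu/mscale/=.
have [sp|sn|/eqP] := ltrgt0P s; last by rewrite (negbTE s0).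
- have -> : f @^-1` `]a, b] = `](a - m) / s, (b - m) / s]%classic.
    apply/seteqP; split=> v; rewrite /f/= !in_itv/= ltr_pdivrMr// ler_pdivlMr//;
    lra.
  rewrite !lebesgue_measure_itv/= !lte_fin ltr_pM2r ?invr_gt0// ltrD2r.
  case: ifP => _; last by rewrite mule0.
  by rewrite -!EFinD -EFinM; congr (_%:E); field.
- have -> : f @^-1` `]a, b] = `[(b - m) / s, (a - m) / s[%classic.
    apply/seteqP; split=> v; rewrite /f/= !in_itv/= ler_ndivrMr// ltr_ndivlMr//;
    lra.
  rewrite !lebesgue_measure_itv/= !lte_fin ltr_nM2r ?invr_lt0// ltrD2r.
  case: ifP => _; last by rewrite mule0.
  by rewrite -!EFinD -EFinM; congr (_%:E); field.
Qed.

Lemma normal_pdf_affine m s v : s != 0 ->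
  normal_pdf 0 1 v = `|s| * normal_pdf m s (m + s * v).
Proof.
move=> s0; rewrite !normal_pdfE ?oner_neq0// mulrA; congr (_ * _).
  rewrite /normal_peak expr1n mul1r -mulrnAr sqrtrM ?sqr_ge0// sqrtr_sqr.
  by rewrite invfM mulrA divff ?mul1r// normr_eq0.
rewrite /normal_fun; congr expR; field; exact: s0.
Qed.

(** The factor [|s|] between the densities cancels the [|s|^-1] by which the affine map rescales
    Lebesgue measure. The sign of [s] is free; [s = -1] later gives the symmetry of the Gaussian. *)
Lemma normal_prob_affine m s A : s != 0 -> measurable A ->
  normal_prob 0 1 ((fun v => m + s * v) @^-1` A) = normal_prob m s A.
Proof.
move=> s0 mA; rewrite /normal_prob.
pose f : measurableTypeR R -> measurableTypeR R := fun v => m + s * v.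
have mf : measurable_fun setT f by exact: measurable_affine.
have mpdf : measurable_fun A (fun x => (normal_pdf m s x)%:E).
  by apply/measurable_EFinP/measurable_funTS; exact: measurable_normal_pdf.
transitivity (\int[mu]_(x in f @^-1` A)
   (`|s|%:E * (normal_pdf m s (f x))%:E))%E.
  by apply: eq_integral => v _; rewrite (normal_pdf_affine m _ s0) EFinM.
have mfA : measurable (f @^-1` A) by rewrite -[X in measurable X]setTI; exact: mf.
rewrite ge0_integralZl//=; first last.
  by move=> x _; rewrite lee_fin normal_pdf_ge0.
  apply/measurable_EFinP/measurable_funTS.
  by apply: measurableT_comp => //; exact: measurable_normal_pdf.
have := @ge0_integral_pushforward _ _ _ _ _ f mf mu A
  (fun x => (normal_pdf m s x)%:E) mA mpdf.
move=> /(_ _)/= <-; last by move=> x _; rewrite lee_fin normal_pdf_ge0.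
have s1 : 0 <= `|s|^-1 by rewrite invr_ge0.
rewrite (@eq_measure_integral _ _ _ _ (mscale (NngNum s1) mu)); last first.
  by move=> B mB _; exact: lebesgue_measure_affine.
rewrite ge0_integral_mscale//=; last by move=> x _; rewrite lee_fin normal_pdf_ge0.
by rewrite muleA -EFinM divff ?mul1e// normr_eq0.
Qed.

Lemma integral_normal_prob m s (f : R -> \bar R) :
  (normal_prob m s).-integrable setT f ->
  (\int[normal_prob m s]_x f x = \int[mu]_x (f x * (normal_pdf m s x)%:E))%E.
Proof.
move=> fint.
have mf : measurable_fun setT f := measurable_int _ fint.
have dom := normal_prob_dominates m s.
rewrite -(Radon_Nikodym_change_of_variables dom)//=.
apply: ae_eq_integral => //.
- exact: emeasurable_funM.
- apply: emeasurable_funM => //=.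
  by apply/measurable_EFinP; exact: measurable_normal_pdf.
(* The Radon-Nikodym derivative and the density have the same integral over every measurable set,
   hence agree almost everywhere. *)
- apply: ae_eqe_mul2l => /=.
  rewrite Radon_NikodymE /=.
  case: cid => /= h [h1 h2 h3].
  apply: (integral_ae_eq measurableT h2).
  + by apply/measurable_EFinP; exact: measurable_normal_pdf.
  + by move=> E E01 mE; rewrite -h3.
Qed.

End GaussianLaws.

(** * Convolution of two centred Gaussian laws *)

Section Convolution.
Context {R : realType}.
Local Notation mu := (@lebesgue_measure R).
Local Notation gauss := (@normal_prob R 0 1).

(* Completing the square in u. *)
Lemma normal_pdf_mul s t u w : t != 0 ->
  let r := Num.sqrt (s ^+ 2 + t ^+ 2) in
  @normal_pdf R (s * u) t w * normal_pdf 0 1 u =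
  normal_pdf 0 r w * normal_pdf (s * w / r ^+ 2) (t / r) u.
Proof.
move=> t0 r.
have t2 : 0 < t ^+ 2 by rewrite exprn_even_gt0.
have st : 0 < s ^+ 2 + t ^+ 2 by rewrite ltr_wpDl ?sqr_ge0.
have r0 : 0 < r by rewrite sqrtr_gt0.
have r2 : r ^+ 2 = s ^+ 2 + t ^+ 2 by rewrite sqr_sqrtr// ltW.
have tr0 : t / r != 0 by rewrite mulf_neq0// invr_neq0// gt_eqF.
have r_n0 : r != 0 by rewrite gt_eqF.
have peak0 (x : R) : 0 <= x ^+ 2 * pi *+ 2.
  by rewrite mulrn_wge0// mulr_ge0 ?sqr_ge0 ?pi_ge0.
rewrite !normal_pdfE ?oner_neq0//.
rewrite /normal_peak /normal_fun mulrACA [RHS]mulrACA -!expRD; congr (_ * expR _).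
  rewrite -!invfM -!sqrtrM//.
  by congr (Num.sqrt _)^-1; field; rewrite gt_eqF.
rewrite exprMn exprVn r2; field.
by rewrite t0 gt_eqF.
Qed.

Lemma normal_pdf_center m s (x : R) : s != 0 ->
  normal_pdf m s x = normal_pdf 0 s (x - m).
Proof. by move=> s0; rewrite !normal_pdfE// normal_fun_center. Qed.

(** Given [u], the variable [s * u + t * v] has law [normal_prob (s * u) t]. Tonelli puts the
    integral over [u] inside; after completing the square, what remains there is a Gaussian density
    in [u], of total mass 1. *)
Lemma normal_convolution s t (A : set R) : t != 0 -> measurable A ->
  (\int[gauss]_u normal_prob (s * u) t A =
   normal_prob 0 (Num.sqrt (s ^+ 2 + t ^+ 2)) A)%E.
Proof.
move=> t0 mA; set r := Num.sqrt _.
pose k := fun p : R * R => ((normal_pdf (s * p.1) t p.2)%:E * (\1_A p.2)%:E)%E.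
have mk : measurable_fun setT k.
  (* Moving the mean into the argument makes joint measurability that of a composition with a single
     fixed density. *)
  rewrite /k; under eq_fun do rewrite normal_pdf_center//.
  apply: emeasurable_funM; apply/measurable_EFinP.
    apply: (measurableT_comp (measurable_normal_pdf 0 t)).
    by apply: measurable_funB => //; exact: measurable_funM.
  by apply: measurableT_comp => //; exact: measurable_indic.
have k0 p : (0 <= k p)%E by rewrite mule_ge0// lee_fin normal_pdf_ge0.
have kE u : normal_prob (s * u) t A = (\int[mu]_w k (u, w))%E.
  rewrite /normal_prob integral_mkcond; apply: eq_integral => w _.
  by rewrite patchE /k/= indicE; case: ifPn => _; rewrite ?mule1 ?mule0.
pose h := fun p : R * R => (k p * (normal_pdf 0 1 p.1)%:E)%E.
have mh : measurable_fun setT h.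
  apply: emeasurable_funM => //; apply/measurable_EFinP.
  by apply: (measurableT_comp (measurable_normal_pdf 0 1)).
have h0 p : (0 <= h p)%E by rewrite mule_ge0// lee_fin normal_pdf_ge0.
have mF : measurable_fun setT (fun u => \int[mu]_w k (u, w))%E.
  exact: measurable_fun_fubini_tonelli_F.
transitivity (\int[mu]_u \int[mu]_w h (u, w))%E.
  under eq_integral do rewrite kE.
  rewrite integral_normal_prob; last first.
    apply/integrableP; split => //.
    apply: (@le_lt_trans _ _ (\int[gauss]_u cst 1 u)%E).
      apply: ge0_le_integral => //=; first exact: measurableT_comp.
      by move=> u _; rewrite -kE gee0_abs// probability_le1.
    by rewrite integral_cst//= mul1e probability_setT ltry.
  apply: eq_integral => u _; rewrite -ge0_integralZr//=.
  - exact: (measurableT_comp mk (measurable_pair1 u)).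
  - by rewrite lee_fin normal_pdf_ge0.
transitivity (\int[mu]_w \int[mu]_u h (u, w))%E; first by apply: (@fubini_tonelli _ _ _ _ _ mu mu h).
rewrite [RHS]integral_mkcond; apply: eq_integral => w _.
rewrite patchE /h /k/= indicE; case: ifPn => _; last first.
  by under eq_integral do rewrite mule0 mul0e; rewrite integral0.
under eq_integral do rewrite mule1 -EFinM normal_pdf_mul// EFinM.
rewrite ge0_integralZl//=.
- by rewrite integral_normal_pdf mule1.
- by apply/measurable_EFinP; exact: measurable_normal_pdf.
- by move=> u _; rewrite lee_fin normal_pdf_ge0.
- by rewrite lee_fin normal_pdf_ge0.
Qed.

End Convolution.

(** * Combining two independent Gaussian variables *)

Section LinearCombination.
Context {R : realType}.
Local Notation mu := (@lebesgue_measure R).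
Local Notation gauss := (@normal_prob R 0 1).

Lemma measurable_preimage_scale (s : R) (A : set R) : measurable A ->
  measurable ((fun v => s * v) @^-1` A).
Proof.
by move=> mA; rewrite -[X in measurable X]setTI; apply: measurable_funM.
Qed.

(** For [t != 0] this is the convolution formula pulled back to the standard Gaussian. Writing the
    law as that of a multiple of a standard Gaussian also covers standard deviation 0, a point mass.
    For [t = 0] the inner set is everything or empty, and [0 <= s] gives [Num.sqrt (s ^+ 2) = s]. *)
Lemma normal_prob_combination (s t : R) (A : set R) : 0 <= s -> measurable A ->
  (\int[gauss]_u gauss [set v | A (s * u + t * v)%R] =
   gauss ((fun v => Num.sqrt (s ^+ 2 + t ^+ 2) * v)%R @^-1` A))%E.
Proof.
move=> s0 mA; have [->|t0] := eqVneq t 0.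
  rewrite expr0n addr0 sqrtr_sqr ger0_norm//.
  rewrite -[RHS]mul1e -[X in (X * _)%E]/(1%:E) -integral_cst//=; last first.
    exact: measurable_preimage_scale.
  rewrite [RHS]integral_mkcond; apply: eq_integral => u _.
  rewrite patchE; case: ifPn => [/set_mem/= Au|/negP Au].
    rewrite (_ : [set v | _] = setT) ?probability_setT//.
    by apply/seteqP; split=> v //= _; rewrite mul0r addr0.
  rewrite (_ : [set v | _] = set0) ?measure0//.
  apply/seteqP; split=> v //=; rewrite mul0r addr0 => Asu.
  by apply: Au; rewrite inE.
under eq_integral do rewrite [gauss _](normal_prob_affine _ t0 mA).
have r0 : Num.sqrt (s ^+ 2 + t ^+ 2) != 0.
  by rewrite sqrtr_eq0 -ltNge ltr_wpDl ?sqr_ge0// exprn_even_gt0.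
rewrite (normal_convolution s t0 mA) -(normal_prob_affine 0 r0 mA).
by congr (gauss _); apply/seteqP; split=> v /=; rewrite add0r.
Qed.

(* The event E carries the variables not yet summed in the induction of
   law_gaussian_sum_indep. *)
Lemma law_linear_combination d (T : measurableType d) (P : probability T R)
    (X Y : {mfun T >-> R}) (E : set T) (s t : R) : 0 <= s -> measurable E ->
  (forall A B, measurable A -> measurable B ->
    P (X @^-1` A `&` Y @^-1` B `&` E) =
    gauss ((fun v => s * v)%R @^-1` A) * gauss B * P E)%E ->
  forall A, measurable A ->
    (P ([set w | A (X w + t * Y w)%R] `&` E) =
     gauss ((fun v => Num.sqrt (s ^+ 2 + t ^+ 2) * v)%R @^-1` A) * P E)%E.
Proof.
move=> s0 mE XYE A mA.
pose f : measurableTypeR R -> measurableTypeR R := fun v => s * v.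
have mf : measurable_fun setT f by exact: measurable_funM.
(* [c] is [P E] as a nonnegative real, so that [m1] below is [P E] times the law of [s] times a
   standard Gaussian. *)
pose c := NngNum (fine_ge0 (measure_ge0 P E)).
have cE : (c%:num)%:E = P E by rewrite /= fineK ?fin_num_measure.
pose fP := isMeasurableFun.Build _ _ _ _ _ mf.
pose g : {mfun _ >-> _} := HB.pack f fP.
pose m1 := mscale c (distribution gauss g).
pose XY : T -> measurableTypeR R * measurableTypeR R := fun w => (X w, Y w).
have mXY : measurable_fun setT XY.
  by apply: measurable_fun_pair => mT B mB; exact: measurable_funP.
have mcomb : measurable_fun setT (fun p : R * R => p.1 + t * p.2).
  by apply: measurable_funD => //; exact: measurable_funM.
pose D := [set p : R * R | A (p.1 + t * p.2)].
have mD : measurable D by rewrite -[X in measurable X]setTI; exact: mcomb.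
(* The hypothesis on rectangles identifies the joint law of [(X, Y)] on the event [E] with a product
   measure, by uniqueness of the latter. *)
have m'E : (m1 \x gauss)%E D = pushforward (mrestr P mE) XY D.
  apply: product_measure_unique => //.
  move=> B C mB mC.
  rewrite -[LHS]/(P (X @^-1` B `&` Y @^-1` C `&` E)) XYE//.
  by rewrite -[X in _ = (X * _)%E]/((c%:num)%:E * gauss (f @^-1` B))%E cE -[RHS]muleA [RHS]muleC.
have mx : measurable_fun setT (fun x : measurableTypeR R => gauss (xsection D x)).
  exact: measurable_fun_xsection.
rewrite -[LHS]/(pushforward (mrestr P mE) XY D) -m'E /product_measure1/=.
rewrite ge0_integral_mscale//.
rewrite cE muleC; congr (_ * _)%E.
rewrite ge0_integral_pushforward//=.
rewrite -(normal_prob_combination t s0 mA); apply: eq_integral => u _.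
congr (gauss _).
by apply/seteqP; split=> v; rewrite /xsection/D/= inE.
Qed.

End LinearCombination.

(** * The law of a finite linear combination, by induction on the index set *)

Section GaussianSum.
Context {R : realType}.
Local Notation gauss := (@normal_prob R 0 1).
Context d (T : measurableType d) (P : probability T R) (I : finType).
Variable xi : I -> {RV P >-> R}.
Hypotheses (xi_indep : mutually_independent xi)
  (xi_gauss : forall i, std_gaussian (xi i)).

Let measurable_sum_xi (x : I -> R) (J : {set I}) :
  measurable_fun setT (fun w => \sum_(i in J) x i * xi i w).
Proof.
under eq_fun do rewrite big_mkcond/=.
apply: measurable_sum => i /=; case: (i \in J) => //=.
by apply: measurable_funM => //; exact: measurable_funP.
Qed.

Let sum_sqr_ge0 (x : I -> R) (J : {set I}) : 0 <= \sum_(i in J) x i ^+ 2.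
Proof. by apply: sumr_ge0 => i _; exact: sqr_ge0. Qed.

(** Mutual independence over [j |: K] and over [K] splits both probabilities into products differing
    by the factor of [j]. This lets an event on [xi j] join the family over [K]. *)
Lemma independent_preimage_cons (j : I) (K : {set I}) (B : I -> set R)
    (C : set R) : j \notin K ->
  measurable C -> (forall i, measurable (B i)) ->
  let B' i := if i == j then C else B i in
  \bigcap_(i in [set` j |: K]) (xi i @^-1` B' i) =
  xi j @^-1` C `&` \bigcap_(i in [set` K]) (xi i @^-1` B i) /\
  P (\bigcap_(i in [set` j |: K]) (xi i @^-1` B' i)) =
  (gauss C * P (\bigcap_(i in [set` K]) (xi i @^-1` B i)))%E.
Proof.
move=> jK mC mB B'.
have B'K i : i \in K -> B' i = B i.
  by move=> iK; rewrite /B' ifN//; apply: contraNneq jK => <-.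
have mB' i : measurable (B' i) by rewrite /B'; case: ifP.
split.
  apply/seteqP; split => w.
    move=> H; split.
      have /= := H j; rewrite in_setU1 eqxx /B' eqxx; exact.
    move=> i /= iK; have /= := H i; rewrite in_setU1 iK orbT B'K//; exact.
  move=> [Hj H] i /=; rewrite in_setU1 => /orP[/eqP->|iK].
    by rewrite /B' eqxx.
  by rewrite B'K//; exact: H.
rewrite !xi_indep// big_setU1//=; congr (_ * _)%E.
  by rewrite /B' eqxx -(xi_gauss j mC).
by apply: eq_bigr => i iK; rewrite B'K.
Qed.

(** Induction on the size of [J]. When [j] is split off [J], the partial sum over [J'] must be
    independent of [xi j] jointly with the events over [K]; the induction hypothesis for [J'] and
    [j |: K] says so, which is why the statement carries the extra events. *)
Lemma law_gaussian_sum_indep (x : I -> R) (J K : {set I}) : {in J, forall i, i \notin K} ->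
  forall A B, measurable A -> (forall i, measurable (B i)) ->
  (P ([set w | A (\sum_(i in J) x i * xi i w)%R] `&`
     \bigcap_(i in [set` K]) (xi i @^-1` B i)) =
   gauss ((fun v => Num.sqrt (\sum_(i in J) x i ^+ 2) * v)%R @^-1` A) *
   P (\bigcap_(i in [set` K]) (xi i @^-1` B i)))%E.
Proof.
move: {2}#|J| (erefl #|J|) => n; elim: n J K => [|n IH] J K cJ JK A B mA mB.
  move/eqP: cJ; rewrite cards_eq0 => /eqP ->.
  under eq_set do rewrite big_set0.
  rewrite big_set0 sqrtr0.
  (* The empty sum is the constant 0, so both events are everything or empty according to whether
     [A] contains 0. *)
  have [A0|A0] := pselect (A 0).
    rewrite (_ : [set _ | _] = setT) ?setTI; last by apply/seteqP; split.
    rewrite (_ : _ @^-1` A = setT) ?probability_setT ?mul1e//.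
    by apply/seteqP; split => v //= _; rewrite mul0r.
  rewrite (_ : [set _ | _] = set0) ?set0I; last by apply/seteqP; split.
  rewrite (_ : _ @^-1` A = set0) ?measure0 ?mul0e//.
  by apply/seteqP; split => v //=; rewrite mul0r.
have /card_gt0P[j jJ] : (0 < #|J|)%N by rewrite cJ.
pose J' := J :\ j.
have jJ' : j \notin J' by rewrite !inE eqxx.
have JE : J = j |: J' by rewrite finset.setD1K.
have cJ' : #|J'| = n by apply/eqP; rewrite -eqSS -cJ (cardsD1 j J) jJ.
have jK : j \notin K by exact: JK.
have mE : measurable (\bigcap_(i in [set` K]) (xi i @^-1` B i)).
  apply: fin_bigcap_measurable => // i _.
  by rewrite -[X in measurable X]setTI; exact: measurable_funP.
pose X : {mfun T >-> R} := HB.pack (fun w => \sum_(i in J') x i * xi i w)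
  (isMeasurableFun.Build _ _ _ _ _ (measurable_sum_xi x J')).
rewrite JE big_setU1//= addrC.
under eq_set do rewrite big_setU1//= addrC.
rewrite -[X in Num.sqrt (X + _)]sqr_sqrtr//.
apply: (law_linear_combination (X := X) (Y := xi j)) => // A' C mA' mC.
have [E1 E2] := independent_preimage_cons jK mC mB.
rewrite -setIA -E1 -[X @^-1` A']/[set w | A' (\sum_(i in J') x i * xi i w)].
rewrite IH//.
- by rewrite E2 muleA.
- move=> i; rewrite !inE => /andP[ij iJ].
  by rewrite negb_or ij JK.
- by move=> i; case: ifP.
Qed.

Lemma law_gaussian_sum (x : I -> R) A : measurable A ->
  P [set w | A (\sum_i x i * xi i w)] =
  gauss ((fun v => Num.sqrt (\sum_i x i ^+ 2) * v) @^-1` A).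
Proof.
move=> mA.
have sumT (f : I -> R) : \sum_(i in finset.setT) f i = \sum_i f i.
  by apply: eq_bigl => i; rewrite inE.
have := @law_gaussian_sum_indep x finset.setT finset.set0 _ A (fun=> setT) mA.
rewrite (_ : \bigcap_(i in _) _ = setT); last by apply/seteqP; split.
rewrite setIT probability_setT mule1 sumT => <- //.
  by congr (P _); apply/seteqP; split => w /=; rewrite sumT.
by move=> i; rewrite !inE.
Qed.

End GaussianSum.

(** * The standard normal distribution function *)

Definition gauss_cdf {R : realType} (y : R) : R := fine (normal_prob 0 1 `]-oo, y]).

Section GaussianCdf.
Context {R : realType}.
Local Notation mu := (@lebesgue_measure R).
Local Notation gauss := (@normal_prob R 0 1).
Local Notation pdf := (@normal_pdf R 0 1).
Local Notation Phi := (@gauss_cdf R).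
Implicit Types a b c m x y l : R.

Lemma gauss_cdfE y : (Phi y)%:E = gauss `]-oo, y].
Proof. by rewrite /gauss_cdf fineK// fin_num_measure. Qed.

Lemma normal_prob_itv_oc a b : a <= b -> gauss `]a, b] = (Phi b - Phi a)%:E.
Proof.
move=> ab; rewrite EFinB !gauss_cdfE.
rewrite (_ : `]-oo, b]%classic = `]-oo, a] `|` `]a, b]); last first.
  by apply: itv_bndbnd_setU; rewrite bnd_simp.
rewrite measureU//=; last first.
  by apply/seteqP; split => // x /=; rewrite !in_itv/= => -[xa /andP[]]; rewrite ltNge xa.
by rewrite addeAC subee ?add0e// fin_num_measure.
Qed.

Lemma normal_prob_itv_cc a b : a <= b -> gauss `[a, b] = (Phi b - Phi a)%:E.
Proof.
move=> ab; rewrite -normal_prob_itv_oc// -(@setU1itv _ _ _ _ false) ?bnd_simp//.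
rewrite measureU//=; first by rewrite /normal_prob integral_set1 add0e.
by apply/seteqP; split => // x /= [->]; rewrite in_itv/= ltxx.
Qed.

Lemma gauss_cdf_lb a b c : a <= b -> (forall x, a < x <= b -> c <= pdf x) ->
  c * (b - a) <= Phi b - Phi a.
Proof.
move=> ab cp; rewrite -lee_fin -normal_prob_itv_oc// /normal_prob.
apply: (@le_trans _ _ (\int[mu]_(x in `]a, b]) c%:E)%E).
  rewrite integral_cst//= lebesgue_measure_itv/= lte_fin.
  case: ltP => ba; first by rewrite -EFinD -EFinM.
  by rewrite mule0 lee_fin (_ : b = a) ?subrr ?mulr0//; apply: le_anti; rewrite ba.
(* The comparison of integrals asks for nonnegative integrands; a negative [c] makes the left side
   nonpositive. *)
have [c0|c0] := leP 0 c; last first.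
  apply: (@le_trans _ _ 0%E).
    by rewrite integral_cst//= mule_le0_ge0// lee_fin ltW.
  by apply: integral_ge0 => x _; rewrite lee_fin normal_pdf_ge0.
apply: ge0_le_integral => //=.
by apply/measurable_EFinP/measurable_funTS; exact: measurable_normal_pdf.
Qed.

Lemma gauss_cdf_ub a b c : a <= b -> (forall x, a < x <= b -> pdf x <= c) ->
  Phi b - Phi a <= c * (b - a).
Proof.
(* For [a = b] the bound on the density is vacuous; for [a < b] its instance at [b] gives
   [0 <= c]. *)
move=> ab cp; have [->|ba] := eqVneq a b; first by rewrite !subrr mulr0.
have {ba}ab : a < b by rewrite lt_neqAle ba.
have c0 : 0 <= c by apply: le_trans (cp b _); rewrite ?normal_pdf_ge0// ab lexx.
rewrite -lee_fin -(normal_prob_itv_oc (ltW ab)) /normal_prob.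
apply: (@le_trans _ _ (\int[mu]_(x in `]a, b]) c%:E)%E); last first.
  by rewrite integral_cst//= lebesgue_measure_itv/= lte_fin ab -EFinD -EFinM.
apply: ge0_le_integral => //=.
- by move=> x _; rewrite lee_fin normal_pdf_ge0.
- by apply/measurable_EFinP/measurable_funTS; exact: measurable_normal_pdf.
Qed.

Lemma gauss_cdf_nd a b : a <= b -> Phi a <= Phi b.
Proof.
move=> ab; rewrite -subr_ge0 -(mul0r (b - a)).
by apply: gauss_cdf_lb => // x _; exact: normal_pdf_ge0.
Qed.

Lemma gauss_cdf_lipschitz a b : a <= b ->
  Phi b - Phi a <= normal_peak 1 * (b - a).
Proof.
by move=> ab; apply: gauss_cdf_ub => // x _; rewrite normal_pdf_ub// oner_neq0.
Qed.

Lemma normal_pdf_sqr_le x y : x ^+ 2 <= y ^+ 2 -> pdf y <= pdf x.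
Proof.
move=> xy; rewrite !normal_pdfE ?oner_neq0// ler_wpM2l ?normal_peak_ge0//.
by rewrite /normal_fun ler_expR !subr0 ler_wpM2r ?lerN2// invr_ge0 mulrn_wge0 ?sqr_ge0.
Qed.

(** The density decreases on the nonnegative half-line, so [pdf m] bounds it above to the right of
    [m] and below to the left. This tangent-line inequality yields concavity without differentiating
    [Phi]. *)
Lemma gauss_cdf_tangent m y : 0 <= m -> 0 <= y ->
  Phi y <= Phi m + pdf m * (y - m).
Proof.
move=> m0 y0; have [my|/ltW ym] := leP m y.
  rewrite addrC -lerBlDr; apply: gauss_cdf_ub => // x /andP[/ltW mx _].
  by apply: normal_pdf_sqr_le; rewrite ler_sqr ?nnegrE// (le_trans m0).
have : pdf m * (m - y) <= Phi m - Phi y.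
  apply: gauss_cdf_lb => // x /andP[/ltW yx xm].
  by apply: normal_pdf_sqr_le; rewrite ler_sqr ?nnegrE// (le_trans y0).
by rewrite -(opprB y) mulrN; lra.
Qed.

Lemma gauss_cdfN y : Phi (- y) = 1 - Phi y.
Proof.
apply: EFin_inj; rewrite EFinB !gauss_cdfE.
(* Only the square of the standard deviation enters the density, so the affine change of variable
   with [s = -1] is a reflection preserving the law. *)
have pdfN : normal_pdf 0 (-1) = pdf.
  apply/funext => x; rewrite !normal_pdfE ?oppr_eq0 ?oner_neq0//.
  by rewrite /normal_peak /normal_fun sqrrN.
have -> : gauss `]-oo, - y] = gauss `[y, +oo[.
  rewrite -[RHS]/(\int[mu]_(x in `[y, +oo[) (pdf x)%:E)%E -pdfN.
  rewrite -[RHS]/(normal_prob 0 (-1) `[y, +oo[).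
  rewrite -(@normal_prob_affine _ 0 (-1)) ?oppr_eq0 ?oner_neq0//; congr (gauss _).
  by apply/seteqP; split => x /=; rewrite !in_itv/= andbT add0r mulN1r lerNr.
rewrite -(_ : gauss `]-oo, y[ = gauss `]-oo, y]).
  rewrite -setCitvl -(@probability_setC _ _ _ (gauss : probability _ _))//.
rewrite -[in RHS](@setUitv1 _ _ _ _ true) ?bnd_simp// measureU//=.
  by rewrite /normal_prob [X in (_ + X)%E]integral_set1 adde0.
by apply/seteqP; split => // x /= [] /[swap] ->; rewrite in_itv/= ltxx.
Qed.

Lemma gauss_cdf0 : Phi 0 = 1 / 2.
Proof. by have := gauss_cdfN 0; rewrite oppr0; lra. Qed.

(** A unit interval ending at [z <= 0] already has positive mass: the density there is at least its
    value at the left end [z - 1]. *)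
Lemma gauss_cdf_gt0 x : 0 < Phi x.
Proof.
pose z := Num.min x 0.
have z0 : z <= 0 by rewrite ge_min lexx orbT.
apply: (@lt_le_trans _ _ (Phi z)); last first.
  by apply: gauss_cdf_nd; rewrite ge_min lexx.
have : pdf (z - 1) * (z - (z - 1)) <= Phi z - Phi (z - 1).
  apply: gauss_cdf_lb; first lra.
  by move=> y yz; apply: normal_pdf_sqr_le; nra.
have : 0 < pdf (z - 1).
  by rewrite normal_pdfE ?oner_neq0// mulr_gt0 ?normal_peak_gt0 ?oner_neq0 ?expR_gt0.
have : 0 <= Phi (z - 1) by rewrite fine_ge0.
by lra.
Qed.

Lemma gauss_cdf_lt1 x : Phi x < 1.
Proof. by have := gauss_cdf_gt0 (- x); rewrite gauss_cdfN subr_gt0. Qed.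

(** If [a > 0], then [Phi a] is at least 1/2 while [Phi b < 1]; the other side is symmetric. The
    strict bounds on [Phi] are what admit the boundary case [eps = 1 / 2]. *)
Lemma gauss_cdf_half_sign a b : 1 / 2 <= Phi b - Phi a -> a <= 0 <= b.
Proof.
move=> h; apply/andP; split; rewrite leNgt; apply/negP => /ltW lt0.
  by have := gauss_cdf_nd lt0; have := gauss_cdf_lt1 b; rewrite gauss_cdf0; lra.
by have := gauss_cdf_nd lt0; have := gauss_cdf_gt0 a; rewrite gauss_cdf0; lra.
Qed.

(** Average the tangent inequalities at the point [m = l * x + (1 - l) * y]; the slope terms
    cancel. *)
Lemma gauss_cdf_concave x y l : 0 <= x -> 0 <= y -> 0 <= l <= 1 ->
  l * Phi x + (1 - l) * Phi y <= Phi (l * x + (1 - l) * y).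
Proof.
move=> x0 y0 /andP[l0 l1]; set m := _ + _ * y.
have m0 : 0 <= m by rewrite addr_ge0// mulr_ge0// subr_ge0.
have hx := ler_wpM2l l0 (gauss_cdf_tangent m0 x0).
have l1' : 0 <= 1 - l by rewrite subr_ge0.
have hy := ler_wpM2l l1' (gauss_cdf_tangent m0 y0).
apply: (le_trans (lerD hx hy)).
rewrite le_eqVlt; apply/orP; left; apply/eqP; rewrite /m; ring.
Qed.

(** By symmetry [- Phi a] is [Phi (- a) - 1], so both terms are concave on the given sign region. *)
Lemma gauss_cdf_diff_concave a a' b b' l : a <= 0 -> a' <= 0 -> 0 <= b -> 0 <= b' ->
  0 <= l <= 1 ->
  l * (Phi b - Phi a) + (1 - l) * (Phi b' - Phi a') <=
  Phi (l * b + (1 - l) * b') - Phi (l * a + (1 - l) * a').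
Proof.
move=> a0 a'0 b0 b'0 l01.
have hb := gauss_cdf_concave b0 b'0 l01.
have := @gauss_cdf_concave (- a) (- a') l.
rewrite !oppr_ge0 => /(_ a0 a'0 l01).
rewrite !mulrN -opprD !gauss_cdfN.
move: hb; nra.
Qed.

(** When [b < a] the event is empty and [Phi b - Phi a] is nonpositive, so [0 < p] makes both sides
    false. *)
Lemma normal_prob_itv_ge (p : R) a b : 0 < p ->
  (p%:E <= gauss [set v | a <= v <= b]%R)%E = (p <= Phi b - Phi a).
Proof.
move=> p0; rewrite -lee_fin.
have [ab|ba] := leP a b.
  by rewrite -normal_prob_itv_cc// (_ : [set v | _] = `[a, b]%classic)//.
rewrite (_ : [set v | _] = set0); last first.
  by apply/seteqP; split => v //= /andP[] /le_trans /[apply]; rewrite leNgt ba.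
rewrite measure0 !lee_fin leNgt p0; apply/esym/negbTE; rewrite -ltNge.
by apply: le_lt_trans p0; rewrite subr_le0; exact: gauss_cdf_nd (ltW ba).
Qed.

Lemma continuous_gauss_cdf : continuous Phi.
Proof.
move=> x; apply/cvgrPdist_le => e e0.
have pk : 0 < normal_peak 1 :> R by rewrite normal_peak_gt0 ?oner_neq0.
near=> y.
have : `|x - y| <= e / normal_peak 1.
  near: y; apply: cvgr_dist_le; first exact: cvg_id.
  by rewrite divr_gt0.
rewrite ler_pdivlMr// mulrC; apply: le_trans.
have [xy|/ltW yx] := leP x y.
  rewrite distrC [`|x - y|]distrC !ger0_norm ?subr_ge0 ?gauss_cdf_nd//.
  exact: gauss_cdf_lipschitz.
rewrite !ger0_norm ?subr_ge0 ?gauss_cdf_nd//; exact: gauss_cdf_lipschitz.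
Unshelve. all: by end_near. Qed.

(** Continuity of the measure along the increasing half-lines []-oo, n]], which exhaust the line. *)
Lemma gauss_cdf_lim1 c : c < 1 -> exists2 M, 0 <= M & c <= Phi M.
Proof.
move=> c1.
have : (gauss `]-oo, n%:R] @[n --> \oo] --> gauss setT)%E.
  rewrite -(_ : \bigcup_n `]-oo, n%:R]%classic = setT).
    apply: nondecreasing_cvg_mu => //; first exact: bigcup_measurable.
    move=> n k nk; apply/subsetPset => x/=; rewrite !in_itv/= => /le_trans.
    by apply; rewrite ler_nat.
  rewrite -subTset => t _/=.
  by exists (Num.truncn t).+1 => //=; rewrite in_itv/= ltW// truncnS_gt.
rewrite probability_setT => /fine_cvg h.
have /cvgr_ge : Phi n%:R @[n --> \oo] --> (1 : R) by exact: h.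
move=> /(_ _ c1) [N _ /(_ N (leqnn N))/= cN].
by exists N%:R.
Qed.

End GaussianCdf.

(** * The perspective cone and the chance constraint *)

Section L2norm.
Context {R : realType} {n : nat}.
Implicit Types x y : 'cV[R]_n.

Lemma l2norm_ge0 x : 0 <= l2norm x.
Proof. exact: sqrtr_ge0. Qed.

Lemma sqr_l2norm x : l2norm x ^+ 2 = \sum_(i < n) x i 0 ^+ 2.
Proof. by rewrite sqr_sqrtr// sumr_ge0// => i _; rewrite sqr_ge0. Qed.

Lemma l2norm_eq0 x : l2norm x = 0 -> forall i, x i 0 = 0.
Proof.
move=> x0 i; have := sqr_l2norm x; rewrite x0 expr0n/= => /esym/eqP.
rewrite psumr_eq0; last by move=> j _; exact: sqr_ge0.
by move=> /allP/(_ i (mem_index_enum _)); rewrite sqrf_eq0 => /eqP.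
Qed.

Lemma cauchy_schwarz x y : \sum_(i < n) x i 0 * y i 0 <= l2norm x * l2norm y.
Proof.
have [x0|x0] := eqVneq (l2norm x) 0.
  by rewrite x0 mul0r big1// => i _; rewrite (l2norm_eq0 x0) mul0r.
have [y0|y0] := eqVneq (l2norm y) 0.
  by rewrite y0 mulr0 big1// => i _; rewrite (l2norm_eq0 y0) mulr0.
set X := l2norm x; set Y := l2norm y.
have XY : 0 < X * Y by rewrite mulr_gt0// lt_neqAle eq_sym l2norm_ge0 ?x0 ?y0.
(* With each vector weighted by the norm of the other, the expanded square has the positive factor
   [X * Y * 2], which can be divided out. *)
have : 0 <= \sum_(i < n) (Y * x i 0 - X * y i 0) ^+ 2.
  by apply: sumr_ge0 => i _; exact: sqr_ge0.
have -> : \sum_(i < n) (Y * x i 0 - X * y i 0) ^+ 2 =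
    (X * Y * 2) * (X * Y - \sum_(i < n) x i 0 * y i 0).
  transitivity (Y ^+ 2 * \sum_(i < n) x i 0 ^+ 2 + X ^+ 2 * \sum_(i < n) y i 0 ^+ 2
      - (X * Y * 2) * \sum_(i < n) x i 0 * y i 0).
    rewrite !mulr_sumr -big_split -sumrB/=.
    by apply: eq_bigr => i _; ring.
  by rewrite -!sqr_l2norm -/X -/Y; ring.
have XY2 : 0 < X * Y * 2 by rewrite mulr_gt0.
by rewrite (pmulr_rge0 _ XY2) subr_ge0.
Qed.

Lemma l2norm_convex x y (l m : R) : 0 <= l -> 0 <= m ->
  l2norm (l *: x + m *: y) <= l * l2norm x + m * l2norm y.
Proof.
move=> l0 m0.
have r0 : 0 <= l * l2norm x + m * l2norm y.
  by rewrite addr_ge0// mulr_ge0// l2norm_ge0.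
rewrite -ler_sqr ?nnegrE ?l2norm_ge0//.
rewrite sqr_l2norm.
under eq_bigr do rewrite !mxE.
have -> : \sum_(i < n) (l * x i 0 + m * y i 0) ^+ 2 =
  l ^+ 2 * l2norm x ^+ 2 + m ^+ 2 * l2norm y ^+ 2 +
  (2 * (l * m)) * \sum_(i < n) x i 0 * y i 0.
  rewrite !sqr_l2norm !mulr_sumr -!big_split/=.
  by apply: eq_bigr => i _; ring.
have := cauchy_schwarz x y.
have lm : 0 <= 2 * (l * m) by rewrite !mulr_ge0.
move=> /(ler_wpM2l lm); nra.
Qed.

End L2norm.

(** * The closed perspective cone: explicit description and convexity *)

Section Perspective.
Context {R : realType} (d' : measure_display) (T' : measurableType d')
  (P' : probability T' R) (zeta : {RV P' >-> R}).
Hypothesis hzeta : std_gaussian zeta.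
Variable eps : R.
Hypotheses (eps_gt0 : 0 < eps) (eps_le : eps <= 1 / 2).
Local Notation Phi := (@gauss_cdf R).
Implicit Types a b t x y z : R.

Let half_le : 1 / 2 <= 1 - eps.
Proof. by move: eps_le; lra. Qed.

Lemma S_epsE x y : S_eps zeta eps (x, y) <-> 1 - eps <= Phi y - Phi x.
Proof.
have e1 : 0 < 1 - eps by move: eps_le; lra.
rewrite -(normal_prob_itv_ge _ _ e1).
rewrite /S_eps/= -[P' _]/(distribution P' zeta [set v | x <= v <= y]) hzeta//.
rewrite (_ : [set v | _] = `[x, y]%classic)//.
Qed.

(** A violated sign is an open condition, so it would also occur at a point of the cone before
    closure, where [gauss_cdf_half_sign] excludes it. *)
Lemma Sbar_eps_sign a b t : Sbar_eps zeta eps (a, b, t) -> a <= 0 <= b.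
Proof.
move=> H; apply/andP; split; rewrite leNgt; apply/negP => lt0.
  have : nbhs (a, b, t) [set q : R * R * R | 0 < q.1.1].
    have : (q.1.1 @[q --> (a, b, t)] --> a).
      by apply: (@cvg_comp _ _ _ fst fst _ (nbhs (a, b))); exact: cvg_fst.
    by move=> /cvgr_gt; apply.
  move=> /H [[[x y] z] [[z0 /S_epsE /= xy]]] /= x0.
  by have /gauss_cdf_half_sign/andP[] := le_trans half_le xy; rewrite pmulr_lle0 ?invr_gt0//; lra.
have : nbhs (a, b, t) [set q : R * R * R | q.1.2 < 0].
  have : (q.1.2 @[q --> (a, b, t)] --> b).
    by apply: (@cvg_comp _ _ _ fst snd _ (nbhs (a, b))); [exact: cvg_fst|exact: cvg_snd].
  by move=> /cvgr_lt; apply.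
move=> /H [[[x y] z] [[z0 /S_epsE /= xy]]] /= x0.
by have /gauss_cdf_half_sign/andP[_] := le_trans half_le xy; rewrite pmulr_lge0 ?invr_gt0//; lra.
Qed.

(** Closure adds nothing at [t > 0]: the ratios and [Phi] are continuous there, so a strict failure
    would persist at nearby points of the cone. *)
Lemma Sbar_eps_gt0 a b t : 0 < t -> Sbar_eps zeta eps (a, b, t) ->
  1 - eps <= Phi (b / t) - Phi (a / t).
Proof.
move=> t0 H; rewrite leNgt; apply/negP => lt.
pose f (q : R * R * R) := Phi (q.1.2 / q.2) - Phi (q.1.1 / q.2).
have cq2 : (q.2 @[q --> (a, b, t)] --> t) by exact: cvg_snd.
have cq1 : (q.1.1 @[q --> (a, b, t)] --> a).
  by apply: (@cvg_comp _ _ _ fst fst _ (nbhs (a, b))); exact: cvg_fst.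
have cq3 : (q.1.2 @[q --> (a, b, t)] --> b).
  by apply: (@cvg_comp _ _ _ fst snd _ (nbhs (a, b))); [exact: cvg_fst|exact: cvg_snd].
have t_neq0 : t != 0 by rewrite gt_eqF.
have : f q @[q --> (a, b, t)] --> Phi (b / t) - Phi (a / t).
  apply: cvgB.
    apply: (cvg_comp _ Phi); last exact: continuous_gauss_cdf.
    by apply: cvgM => //; exact: cvgV.
  apply: (cvg_comp _ Phi); last exact: continuous_gauss_cdf.
  by apply: cvgM => //; exact: cvgV.
move=> /cvgr_lt/(_ _ lt) /H [[[x y] z] [[z0 /S_epsE /= xy]]] /=.
by rewrite /f/= ltNge xy.
Qed.

Lemma Sbar_eps_0 a b : a <= 0 <= b -> Sbar_eps zeta eps (a, b, 0).
Proof.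
move=> /andP[a0 b0] U /nbhs_ballP[e /= e0 eU].
have [M M0 MPhi] : exists2 M : R, 0 <= M & 1 - eps / 2 <= Phi M.
  by apply: gauss_cdf_lim1; move: eps_gt0; lra.
(* Chosen so that [M * z + z = e / 2]. The point [(a - M * z, b + M * z, z)] is then within [e] of
   [(a, b, 0)], and its ratios lie beyond [- M] and [M], giving mass at least [2 * Phi M - 1], hence
   at least [1 - eps]. *)
pose z := e / 2 / (1 + M).
have M1 : 0 < 1 + M by rewrite ltr_pwDl.
have z0 : 0 < z by rewrite !divr_gt0.
have Mz : M * z + z < e.
  rewrite -{2}(mul1r z) -mulrDl addrC /z mulrC divfK ?gt_eqF//; lra.
have Mz0 : 0 <= M * z by rewrite mulr_ge0// ltW.
exists (a - M * z, b + M * z, z); split; last first.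
  apply: eU; split; first split; rewrite /ball/=.
  - by rewrite opprB addrC subrK ger0_norm//; lra.
  - by rewrite opprD addrA subrr sub0r normrN ger0_norm//; lra.
  - by rewrite sub0r normrN gtr0_norm//; lra.
split => //; apply/S_epsE.
have : Phi ((a - M * z) / z) <= Phi (- M).
  apply: gauss_cdf_nd; rewrite ler_pdivrMr//; lra.
have : Phi M <= Phi ((b + M * z) / z).
  apply: gauss_cdf_nd; rewrite ler_pdivlMr//; lra.
by rewrite gauss_cdfN; lra.
Qed.

Lemma Sbar_epsP a b t : 0 <= t -> Sbar_eps zeta eps (a, b, t) <->
  a <= 0 <= b /\ (0 < t -> 1 - eps <= Phi (b / t) - Phi (a / t)).
Proof.
move=> t0; split=> [H|[ab H]].
  by split; [exact: Sbar_eps_sign H|move=> tp; exact: Sbar_eps_gt0].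
move: t0; rewrite le_eqVlt => /predU1P[<-|tp]; first exact: Sbar_eps_0.
by apply: subset_closure; split => //; apply/S_epsE; exact: H.
Qed.

Lemma Sbar_eps_convex a b t a' b' t' l m : 0 <= t -> 0 <= t' ->
  0 < l -> 0 < m -> l + m = 1 ->
  Sbar_eps zeta eps (a, b, t) -> Sbar_eps zeta eps (a', b', t') ->
  Sbar_eps zeta eps (l * a + m * a', l * b + m * b', l * t + m * t').
Proof.
move=> t0 t'0 l0 m0 lm.
have tt0 : 0 <= l * t + m * t' by rewrite addr_ge0// mulr_ge0// ltW.
move=> /(Sbar_epsP _ _ t0)[/andP[a0 b0] H] /(Sbar_epsP _ _ t'0)[/andP[a'0 b'0] H'].
apply/Sbar_epsP => //; split; first by apply/andP; split; nra.
have mono (u v r u' v' r' : R) : 0 < r -> r' = r -> u' <= u -> v <= v' ->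
    1 - eps <= Phi (v / r) - Phi (u / r) ->
    1 - eps <= Phi (v' / r') - Phi (u' / r').
  move=> r0 -> uu vv h.
  have : Phi (u' / r) <= Phi (u / r) by apply: gauss_cdf_nd; rewrite ler_pM2r ?invr_gt0.
  have : Phi (v / r) <= Phi (v' / r) by apply: gauss_cdf_nd; rewrite ler_pM2r ?invr_gt0.
  lra.
have cancel (u v r k : R) : 0 < r -> 0 < k -> 1 - eps <= Phi (v / r) - Phi (u / r) ->
    1 - eps <= Phi (k * v / (k * r)) - Phi (k * u / (k * r)).
  by move=> r0 k0; rewrite -!mulf_div !divff ?gt_eqF// !mul1r.
(* A point at height 0 has [a <= 0 <= b], so adding it only widens the other interval while the
   weight cancels from the ratios. Two such points contradict the positive height. *)
move: t0; rewrite le_eqVlt => /predU1P[t0|t0].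
  move: t'0; rewrite le_eqVlt => /predU1P[<-|t'0]; first by rewrite -t0 !mulr0 addr0 ltxx.
  move=> _; apply: (mono (m * a') (m * b') (m * t')); rewrite ?mulr_gt0//.
  - by rewrite -t0 mulr0 add0r.
  - nra.
  - nra.
  - by apply: cancel => //; exact: H'.
move: t'0; rewrite le_eqVlt => /predU1P[t'0|t'0].
  move=> _; apply: (mono (l * a) (l * b) (l * t)); rewrite ?mulr_gt0//.
  - by rewrite -t'0 mulr0 addr0.
  - nra.
  - nra.
  - by apply: cancel => //; exact: H.
move=> TT; set s := l * t + m * t'.
(* The ratios of the combined point are convex combinations of the original ratios with this weight,
   which reduces the claim to concavity of the difference of [Phi]. *)
pose th := l * t / s.
have th01 : 0 <= th <= 1.
  have [lt0 mt0] : 0 < l * t /\ 0 < m * t' by rewrite !mulr_gt0.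
  apply/andP; split; first by rewrite divr_ge0// ltW.
  by rewrite ler_pdivrMr// mul1r lerDl ltW.
have thE (u v : R) : (l * u + m * v) / s = th * (u / t) + (1 - th) * (v / t').
  by rewrite /th /s; field; rewrite !gt_eqF.
rewrite !thE.
have sg (u r : R) : 0 < r -> 0 <= u -> 0 <= u / r by move=> r0 u0; rewrite divr_ge0// ltW.
have sgn (u r : R) : 0 < r -> u <= 0 -> u / r <= 0.
  by move=> r0 u0; rewrite pmulr_lle0 ?invr_gt0.
have := @gauss_cdf_diff_concave R (a / t) (a' / t') (b / t) (b' / t') th
  (sgn _ _ t0 a0) (sgn _ _ t'0 a'0) (sg _ _ t0 b0) (sg _ _ t'0 b'0) th01.
apply: le_trans.
move/andP: th01 => [th0 th1]; have := H t0; have := H' t'0; nra.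
Qed.

End Perspective.

(** * The chance constraint in terms of the norm of [x] *)

Section ChanceSet.
Context {R : realType} (d : measure_display) (T : measurableType d)
  (P : probability T R) (n : nat) (xi : 'I_n -> {RV P >-> R}).
Hypothesis hxi : iid_std_gaussian xi.
Variable eps : R.
Hypotheses (eps_ge0 : 0 <= eps) (eps_lt1 : eps < 1).
Local Notation Phi := (@gauss_cdf R).

Lemma chance_setE (a b : R) (x : 'cV[R]_n) : chance_set xi eps (a, b, x) <->
  ((1 - eps)%:E <= normal_prob 0 1 [set v | a <= l2norm x * v <= b]%R)%E.
Proof.
have [xi_indep xi_gauss] := hxi.
have := @law_gaussian_sum _ _ _ P _ xi xi_indep xi_gauss (fun i => x i 0) `[a, b].
rewrite /chance_set/= => /(_ (measurable_itv _)).
rewrite [X in P X](_ : _ =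
  [set w | a <= \sum_(i < n) x i 0 * xi i w <= b]); last first.
  by apply/seteqP; split=> w /=; rewrite in_itv.
by move=> ->; rewrite [X in normal_prob 0 1 X](_ : _ =
  [set v | a <= l2norm x * v <= b]).
Qed.

Lemma chance_set_gt0 (a b : R) (x : 'cV[R]_n) : 0 < l2norm x ->
  chance_set xi eps (a, b, x) <->
  1 - eps <= Phi (b / l2norm x) - Phi (a / l2norm x).
Proof.
move=> x0; rewrite chance_setE -normal_prob_itv_ge ?subr_gt0//.
rewrite [X in normal_prob 0 1 X](_ : _ =
  [set v | a / l2norm x <= v <= b / l2norm x])//.
by apply/seteqP; split=> v /=; rewrite ler_pdivrMr// ler_pdivlMr// mulrC.
Qed.

(** The variable is the constant 0, so the probability is 0 or 1, and [0 < 1 - eps <= 1] separates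
    the two. *)
Lemma chance_set_eq0 (a b : R) (x : 'cV[R]_n) : l2norm x = 0 ->
  chance_set xi eps (a, b, x) <-> a <= 0 <= b.
Proof.
move=> x0; rewrite chance_setE x0; split=> [|ab].
  apply: contraTT => ab; rewrite -ltNge (_ : [set v | _] = set0).
    by rewrite measure0 lte_fin subr_gt0.
  by apply/seteqP; split => v //=; rewrite mul0r; exact/negP.
rewrite (_ : [set v | _] = setT).
  by rewrite probability_setT lee_fin gerBl.
by apply/seteqP; split => v //= _; rewrite mul0r.
Qed.

End ChanceSet.

(** * Convexity of the lifted set, the projection identity, and convexity of the chance set *)

Theorem theorem1 (R : realType)
    (d : measure_display) (T : measurableType d) (P : probability T R)
    (d' : measure_display) (T' : measurableType d') (P' : probability T' R)
    (zeta : {RV P' >-> R}) (hzeta : std_gaussian zeta)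
    (n : nat) (xi : 'I_n -> {RV P >-> R}) (hxi : iid_std_gaussian xi)
    (eps : R) (heps0 : 0 < eps) (heps : eps <= 1 / 2) :
  [/\ convex_set (lifted_set zeta n eps),
      chance_set xi eps = [set q.1 | q in lifted_set zeta n eps]
    & convex_set (chance_set xi eps)].
Proof.
have eps1 : eps < 1 by move: heps; lra.
have lifted_convex : convex_set (lifted_set zeta n eps).
  apply/convex_setW => -[[[a b] x] t] [[[a' b'] x'] t'] /[!inE].
  move=> [xt H] [xt' H'] k k0 k1.
  have k1' : 0 < 1 - k%:num by rewrite subr_gt0.
  rewrite inE; split.
    apply: (le_trans (l2norm_convex _ _ (ltW k0) (ltW k1'))).
    by apply: lerD; rewrite ler_wpM2l// ltW.
  have t0 := le_trans (l2norm_ge0 x) xt.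
  have t'0 := le_trans (l2norm_ge0 x') xt'.
  exact: (Sbar_eps_convex hzeta heps0 heps t0 t'0 k0 k1' (subrKC _ _) H H').
have proj : chance_set xi eps = [set q.1 | q in lifted_set zeta n eps].
  apply/seteqP; split=> [[[a b] x]|_ [[[[a b] x] t] [xt H] <-]].
    (* The smallest admissible height is the witness. *)
    move=> C; exists (a, b, x, l2norm x) => //; split => //.
    apply/(Sbar_epsP hzeta heps0 heps) => //; first exact: l2norm_ge0.
    have [x0|x0] := eqVneq (l2norm x) 0.
      by split; [exact/(chance_set_eq0 hxi (ltW heps0) eps1 _ _ x0)|rewrite x0 ltxx].
    have xp : 0 < l2norm x by rewrite lt_neqAle eq_sym x0 l2norm_ge0.
    move: C => /(chance_set_gt0 hxi eps1 _ _ xp) C; split => //.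
    have /gauss_cdf_half_sign : 1 / 2 <= gauss_cdf (b / l2norm x) - gauss_cdf (a / l2norm x).
      by apply: le_trans C; move: heps; lra.
    by rewrite pmulr_lle0 ?pmulr_lge0 ?invr_gt0.
  have [ab Hpos] := (Sbar_epsP hzeta heps0 heps a b (le_trans (l2norm_ge0 x) xt)).1 H.
  have [x0|x0] := eqVneq (l2norm x) 0; first exact/(chance_set_eq0 hxi (ltW heps0) eps1 _ _ x0).
  have xp : 0 < l2norm x by rewrite lt_neqAle eq_sym x0 l2norm_ge0.
  have tp := lt_le_trans xp xt.
  apply/(chance_set_gt0 hxi eps1 _ _ xp).
  apply: (le_trans (Hpos tp)); move/andP: ab => [a0 b0].
  (* Lowering the height from [t] to the norm moves [b / t] up and [a / t] down, because
     [a <= 0 <= b]. *)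
  have ixt : t^-1 <= (l2norm x)^-1 by rewrite lef_pV2.
  by apply: lerB; apply: gauss_cdf_nd; [rewrite ler_wpM2l|rewrite ler_wnM2l].
split => //.
rewrite proj => p p' k /[!inE] -[q qL <-] [q' q'L <-].
(* Two points are lifted and combined upstairs; the projection commutes with convex combinations. *)
exists (conv k (q : convex_lmodType _) q') => //.
by rewrite -inE; apply: lifted_convex; rewrite inE.
Qed.
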